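(* Let $n \geq 2$ be a fixed integer. Let $S(m,n)$ be the size of the largest antichains in the product poset $[m]^n$. Then, as $m \to \infty$, $$S(m,n) = m^{n-1} g(n) + \mathcal{O}(m^{n-2}),$$ where, when $n$ is even, $$g(n) = 1 - 2 \sum_{j=0}^{\frac{n-4}{2}} \ \sum_{i=0}^{j} (-1)^{i} \, \frac{(1+j-i)^{n-1} - (j-i)^{n-1}}{i! \, (n-1-i)!},$$ and, when $n$ is odd, $$g(n) = 1 - 2 \sum_{j=0}^{\frac{n-5}{2}} \ \sum_{i=0}^{j} (-1)^{i} \, \frac{(1+j-i)^{n-1} - (j-i)^{n-1}}{i! \, (n-1-i)!} - 2 \sum_{i=0}^{\frac{n-3}{2}} (-1)^{i} \, \frac{\left(\frac{n}{2}-1-i\right)^{n-1} - \left(\frac{n-3}{2}-i\right)^{n-1}}{i! \, (n-1-i)!}.$$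
   Context: For a positive integer $m$, $[m] = \{1, \ldots, m\}$ with its usual linear order, and $[m]^n$ is ordered componentwise: $x \preceq y$ if and only if $x_i \leq y_i$ for all $i \in \{1,\ldots,n\}$. An antichain is a subset of pairwise incomparable elements (no two distinct elements are comparable). $S(m,n)$ denotes the maximal cardinality of an antichain in $([m]^n, \preceq)$. Sums whose upper limit is smaller than their lower limit are empty and equal $0$ (e.g. the sum over $j$ when $n=2$ or $n=3$). The constant in $\mathcal{O}(m^{n-2})$ may depend on $n$. *)

(* Defs.v *)
From mathcomp Require Import all_boot all_order all_algebra.
From mathcomp Require Import all_classical all_reals all_analysis.

Set Implicit Arguments.
Unset Strict Implicit.
Unset Printing Implicit Defensive.

Import Order.TTheory GRing.Theory Num.Theory numFieldNormedType.Exports.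

Local Open Scope ring_scope.

(* The chain {1, ..., m} is encoded as 'I_m = {0, ..., m - 1}, so the poset
   [m]^n is n.-tupleprod 'I_m, whose order is componentwise (see leEtprod). *)
Definition antichain (d : Order.disp_t) (T : finPOrderType d) (A : {set T}) :
  bool := [forall x in A, forall y in A, (x != y) ==> (x >< y)%O].

Definition max_antichain (m n : nat) : nat :=
  \max_(A : {set n.-tupleprod 'I_m} | antichain A) #|A|.

Section Density.
Variable R : realType.

Definition g_term (n j i : nat) : R :=
  (-1) ^+ i
  * (((1 + j%:R - i%:R) ^+ (n - 1) - (j%:R - i%:R) ^+ (n - 1))
     / (i`!%:R * (n - 1 - i)`!%:R)).

(* A sum with inclusive upper limit u is written with strict bound u + 1:
   (n - 4)/2 + 1 = (n - 2)/2 and (n - 5)/2 + 1 = (n - 3)/2, which are natural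
   numbers for n >= 2 of the relevant parity, and 0 when n = 2 or n = 3. *)
Definition g_even (n : nat) : R :=
  1 - 2 * \sum_(0 <= j < (n - 2)./2) \sum_(0 <= i < j.+1) g_term n j i.

Definition g_odd (n : nat) : R :=
  1 - 2 * \sum_(0 <= j < (n - 3)./2) \sum_(0 <= i < j.+1) g_term n j i
    - 2 * \sum_(0 <= i < (n - 3)./2.+1)
        (-1) ^+ i
        * (((n%:R / 2 - 1 - i%:R) ^+ (n - 1)
            - ((n%:R - 3) / 2 - i%:R) ^+ (n - 1))
           / (i`!%:R * (n - 1 - i)`!%:R)).

Definition g (n : nat) : R := if odd n then g_odd n else g_even n.

End Density.

(* Main.v *)
Require Import Defs.
From mathcomp Require Import all_boot all_order all_algebra.
From mathcomp Require Import all_classical all_reals all_analysis.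
From mathcomp Require Import zify ring lra.

Set Implicit Arguments.
Unset Strict Implicit.
Unset Printing Implicit Defensive.

Import Order.TTheory GRing.Theory Num.Theory numFieldNormedType.Exports.

(* The grid [m]^n has a decomposition into symmetric chains, each of which meets
   the middle layer exactly once, so the middle layer is a largest antichain.
   Forgetting one coordinate, the middle layer is the set of points of
   [m]^(n-1) whose coordinate sum lies in a window of length m; by the symmetry
   x -> m - 1 - x, its complement has the size of two lower sets {sum < t} with
   t = (n/2 - 1) m + O(1). Inclusion-exclusion counts each of them as
   m^(n-1) F(n/2 - 1) + O(m^(n-2)), where F is the distribution function of the
   sum of n - 1 independent uniform variables on [0, 1]. The double sum over j
   and i in g telescopes over j, which gives g(n) = 1 - 2 F(n/2 - 1). *)

(** * The grid as a list of coordinate lists *)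

Fixpoint box (m n : nat) : seq (seq nat) :=
  if n is n'.+1 then [seq i :: y | y <- box m n', i <- iota 0 m] else [:: [::]].

Lemma mem_box (m n : nat) (s : seq nat) :
  (s \in box m n) = (size s == n) && all (fun i => i < m) s.
Proof.
elim: n s => [|n IH] s; first by rewrite inE; case: s.
apply/allpairsP/idP => [[[y i] /= [yb]]|].
  rewrite mem_iota add0n /= => im ->.
  by move: yb; rewrite IH => /andP[/eqP <- ay] /=; rewrite eqxx im.
case: s => [//|i y] /= /and3P[sy im ay]; exists (y, i).
by rewrite mem_iota IH -eqSS sy ay.
Qed.

Lemma box_uniq (m n : nat) : uniq (box m n).
Proof.
elim: n => [//|n IH] /=.
by apply: allpairs_uniq; rewrite ?iota_uniq // => -[x i] [y j] _ _ /= [-> ->].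
Qed.

Lemma size_box (m n : nat) : size (box m n) = m ^ n.
Proof. by elim: n => [//|n IH]; rewrite size_allpairs IH size_iota expnSr. Qed.

Lemma big_box (m n : nat) (F : seq nat -> nat) :
  \sum_(s <- box m n.+1) F s
  = \sum_(y <- box m n) \sum_(0 <= i < m) F (i :: y).
Proof. by rewrite /= big_allpairs_dep /= /index_iota subn0. Qed.

Lemma count_box (m n : nat) (P : pred (seq nat)) :
  count P (box m n.+1)
  = \sum_(y <- box m n) count (fun i => P (i :: y)) (iota 0 m).
Proof.
rewrite -sum1_count big_mkcond big_box; apply: eq_bigr => y _.
by rewrite -sum1_count [RHS]big_mkcond /index_iota subn0.
Qed.

Lemma sumn_box (m n : nat) (y : seq nat) : y \in box m n -> sumn y <= n * m.-1.
Proof.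
elim: n y => [|n IH] y; first by rewrite inE => /eqP ->.
case/allpairsP => -[z i] /= [/IH zb]; rewrite mem_iota => /= im -> /=; nia.
Qed.

(** The reflection of every coordinate, [i] to [m.-1 - i], permutes the box; the induction applies
    it to one coordinate at a time by reversing the sum over [i]. *)
Lemma box_sum_rev (m n : nat) (F : nat -> nat) :
  \sum_(y <- box m n) F (sumn y) = \sum_(y <- box m n) F (n * m.-1 - sumn y).
Proof.
elim: n F => [|n IH] F; first by rewrite /= !big_seq1.
rewrite !big_box exchange_big [RHS]exchange_big [RHS]big_nat_rev /=.
apply: eq_big_nat => i im.
rewrite (IH (fun u => F (i + u))); apply: eq_big_seq => y /sumn_box yb /=.
congr F; rewrite mulSn; lia.
Qed.

(** * Symmetric chains and the middle layer *)

(* The symmetric chain decomposition of the product of a chain [s] with the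
   chain {0, ..., b - 1}: peel off the column over the head of [s] followed by
   the top row, and recurse on the remaining rectangle. *)
Fixpoint hooks (s : seq (seq nat)) (b : nat) : seq (seq (seq nat)) :=
  if s is x :: s' then
    if b is b'.+1 then
      ([seq i :: x | i <- iota 0 b] ++ [seq b' :: y | y <- s']) :: hooks s' b'
    else [::]
  else [::].

Lemma count_hooks (s : seq (seq nat)) (b : nat) (P : pred (seq nat)) :
  count P (flatten (hooks s b))
  = \sum_(y <- s) count (fun i => P (i :: y)) (iota 0 b).
Proof.
elim: s b => [|x s IH] [|b]; rewrite ?big_nil //.
  by rewrite big1.
have -> : flatten (hooks (x :: s) b.+1) = [seq i :: x | i <- iota 0 b.+1]
  ++ [seq b :: y | y <- s] ++ flatten (hooks s b) by rewrite catA.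
rewrite big_cons !count_cat IH !count_map.
congr (_ + _); rewrite -sum1_count big_mkcond -big_split.
apply: eq_bigr => y _.
by rewrite -(addn1 b) iotaD count_cat addnC /= addn0; case: ifP.
Qed.

(* [2 r + size s = K + 1] says that the lowest and highest ranks of [s],
   namely [r] and [r + size s - 1], sum to [K]. *)
Definition symchain (K : nat) (s : seq (seq nat)) : Prop :=
  exists r, [/\ map sumn s = iota r (size s), r.*2 + size s = K.+1,
    0 < size s & pairwise (all2 leq) s].

Lemma all2_leq_refl (x : seq nat) : all2 leq x x.
Proof. by elim: x => //= i x ->; rewrite leqnn. Qed.

(** The numerical hypothesis says that the extreme ranks [r] and [r + size s + b - 2] of the
    rectangle sum to [K]. The first hook runs through all these ranks; peeling it off raises the
    lowest rank by one and lowers the highest by one, so the same [K] serves in the recursion. *)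
Lemma symchain_hooks (K r b : nat) (s c : seq (seq nat)) :
  map sumn s = iota r (size s) -> r.*2 + size s + b = K.+2 ->
  pairwise (all2 leq) s -> c \in hooks s b -> symchain K c.
Proof.
elim: s r b => [|x s IH] r [|b] //.
rewrite map_cons [size _]/= [iota _ _]/= => -[sx ss] HK.
rewrite [pairwise _ _]/= => /andP[xs ps].
have -> : hooks (x :: s) b.+1 =
  ([seq i :: x | i <- iota 0 b.+1] ++ [seq b :: y | y <- s]) :: hooks s b by [].
rewrite in_cons => /orP[/eqP ->|]; last first.
  by apply: IH ss _ ps; rewrite -HK doubleS; lia.
have sz : size ([seq i :: x | i <- iota 0 b.+1] ++ [seq b :: y | y <- s])
    = b.+1 + size s by rewrite size_cat !size_map size_iota.
exists r; split; rewrite ?sz //; last 2 first.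
- by lia.
- rewrite pairwise_cat pairwise_map; apply/and3P; split.
  + apply/allrelP => _ _ /mapP[i ib ->] /mapP[y ys ->]; rewrite [all2 _ _ _]/=.
    move: ib; rewrite mem_iota => /= ib.
    by rewrite (allP xs) ?andbT.
  + apply: (@sub_pairwise _ leq) => [i j /= ->|]; first exact: all2_leq_refl.
    by rewrite -sorted_pairwise ?iota_sorted //; exact: leq_trans.
  + by rewrite pairwise_map; apply: sub_pairwise ps => y z /=; rewrite leqnn.
rewrite map_cat -!map_comp iotaD; congr (_ ++ _).
  rewrite -{1}(addn0 r) iotaDl; apply: eq_map => i /=.
  by rewrite sx addnC.
by rewrite -addSnnS addnC iotaDl -ss -map_comp.
Qed.

(** Each chain spans a rectangle with the new coordinate, which [hooks] cuts into chains. Equality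
    of all counts expresses that the chains partition the box, up to the order of the list. *)
Lemma symchain_decomposition (m n : nat) : 0 < m ->
  exists cs : seq (seq (seq nat)),
    (forall P, count P (flatten cs) = count P (box m n)) /\
    (forall c, c \in cs -> symchain (n * m.-1) c).
Proof.
move=> m0; elim: n => [|n [cs [ccs scs]]].
  exists [:: [:: [::]]]; split=> // c; rewrite inE => /eqP ->.
  by exists 0.
exists (flatten [seq hooks c m | c <- cs]); split=> [P|e /flatten_mapP[c cin]].
  rewrite count_box; transitivity
    (\sum_(y <- flatten cs) count (fun i => P (i :: y)) (iota 0 m)).
    rewrite big_flatten /=; elim: (cs) => [|c s IH]; first by rewrite big_nil.
    by rewrite big_cons -IH /= flatten_cat count_cat count_hooks.
  apply: perm_big; apply/permP => Q; exact: ccs.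
have [r [sr rK _ pc]] := scs c cin.
apply: symchain_hooks sr _ pc; rewrite rK mulSn; lia.
Qed.

Lemma count_symchain_antichain (K : nat) (A : pred (seq nat))
    (c : seq (seq nat)) :
  symchain K c -> {in A &, forall x y, all2 leq x y -> x = y} -> count A c <= 1.
Proof.
case=> r [sr _ _ pc] antiA.
have uc : uniq c by apply: (@map_uniq _ _ sumn); rewrite sr iota_uniq.
have := pairwise_filter A pc; have := filter_uniq A uc.
have := filter_all A c; rewrite -size_filter.
case: (seq.filter A c) => [//|x [//|y s]] /= /and3P[Ax Ay _] /andP[].
rewrite inE negb_or => /andP[/eqP xy _ _] /andP[/andP[lexy _] _].
by case: xy; apply: antiA.
Qed.

(** The ranks of [c] are the consecutive integers from [r] to [K - r], an interval symmetric about
    [K / 2]. *)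
Lemma count_symchain_middle (K : nat) (c : seq (seq nat)) :
  symchain K c -> count (fun y => sumn y == K./2) c = 1.
Proof.
case=> r [sr rK c0 _].
rewrite -(count_map sumn (pred1 K./2)) sr count_uniq_mem ?iota_uniq //.
by rewrite mem_iota; apply/eqP; rewrite eqb1; lia.
Qed.

Lemma antichain_le_middle (m n : nat) (A : pred (seq nat)) : 0 < m ->
  {in A &, forall x y, all2 leq x y -> x = y} ->
  count A (box m n) <= count (fun y => sumn y == (n * m.-1)./2) (box m n).
Proof.
move=> m0 antiA; have [cs [ccs scs]] := symchain_decomposition n m0.
rewrite -!ccs !count_flatten !sumnE !big_map !big_seq; apply: leq_sum => c cin.
have sc := scs c cin.
by rewrite (count_symchain_middle sc) (count_symchain_antichain sc).
Qed.

(** * Transfer to the poset of tuples *)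

Definition vals (m n : nat) (x : n.-tupleprod 'I_m) : seq nat :=
  [seq val i | i <- (x : n.-tuple 'I_m)].

Lemma vals_inj (m n : nat) : injective (@vals m n).
Proof. by move=> x y /(inj_map val_inj)/val_inj. Qed.

Lemma vals_box (m n : nat) (x : n.-tupleprod 'I_m) : vals x \in box m n.
Proof.
rewrite mem_box size_map size_tuple eqxx.
by apply/allP => _ /mapP[i _ ->]; exact: ltn_ord.
Qed.

Lemma box_vals (m n : nat) (s : seq nat) :
  s \in box m n -> exists x : n.-tupleprod 'I_m, s = vals x.
Proof.
rewrite mem_box => /andP[/eqP sn /allP sm].
case: m sm => [|m] sm.
  case: s sn sm => [<- _|i s _ sm]; first by exists [tuple].
  by have := sm i (mem_head _ _).
have sz : size [seq inord i : 'I_m.+1 | i <- s] == n by rewrite size_map sn.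
exists (Tuple sz); rewrite /vals /= -map_comp -[LHS]map_id.
by apply/eq_in_map => i /sm im /=; rewrite inordK.
Qed.

Lemma le_vals (m n : nat) (x y : n.-tupleprod 'I_m) :
  (x <= y)%O = all2 leq (vals x) (vals y).
Proof.
(* The order on tuples is inherited from sequences, where induction on the length is available. *)
pose le_seq (s t : seqprod 'I_m) := (s <= t)%O.
have le_seqE s t : size s = size t ->
    le_seq s t = all2 leq [seq val i | i <- s] [seq val i | i <- t].
  elim: s t => [|i s IH] [|j t] //= [/IH <-]; exact: le_cons.
by apply: le_seqE; rewrite !size_tuple.
Qed.

Lemma all2_leq_sumn (s t : seq nat) :
  all2 leq s t -> sumn s <= sumn t ?= iff (s == t).
Proof.
elim: s t => [|i s IH] [|j t] //= /andP[lij /IH lst].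
by rewrite eqseq_cons; apply: leqif_add lst; exact: leqif_eq.
Qed.

Lemma max_antichain_middle (m n : nat) : 0 < m ->
  max_antichain m n = count (fun y => sumn y == (n * m.-1)./2) (box m n).
Proof.
move=> m0; apply/eqP; rewrite eqn_leq; apply/andP; split.
  apply/bigmax_leqP => A /forall_inP antiA.
  pose L := [seq vals x | x <- enum A].
  have uL : uniq L by rewrite map_inj_uniq ?enum_uniq //; exact: vals_inj.
  have -> : #|A| = size L by rewrite size_map cardE.
  apply: leq_trans (antichain_le_middle (A := mem L) _ m0 _); last first.
    move=> _ _ /mapP[x xA ->] /mapP[y yA ->]; rewrite -le_vals => lexy.
    move: xA yA; rewrite !mem_enum => /antiA/forall_inP h /h.
    by case: (x =P y) => [-> //|_]; rewrite /Order.comparable lexy.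
  rewrite -size_filter uniq_leq_size // => s sL.
  rewrite mem_filter; apply/andP; split; first exact: sL.
  by case/mapP: sL => x _ ->; exact: vals_box.
(* Conversely the middle layer is an antichain: comparable points with equal sums coincide. *)
pose A := [set x : n.-tupleprod 'I_m | sumn (vals x) == (n * m.-1)./2].
have antiA : antichain A.
  apply/forall_inP => x; rewrite inE => /eqP sx.
  apply/forall_inP => y; rewrite inE => /eqP sy; apply/implyP; apply: contra.
  wlog lexy : x y sx sy / (x <= y)%O => [IH /orP[] le|_].
  - exact: IH sx sy le (le_comparable le).
  - by rewrite eq_sym; exact: IH sy sx le (le_comparable le).
  move: lexy; rewrite le_vals => /all2_leq_sumn[_].
  by rewrite sx sy eqxx => /esym/eqP/vals_inj ->.
apply: leq_trans (leq_bigmax_cond _ antiA).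
have -> : #|A| = size [seq vals x | x <- enum A] by rewrite size_map cardE.
rewrite -size_filter uniq_leq_size ?filter_uniq ?box_uniq // => s.
rewrite mem_filter => /andP[sk /box_vals[x sx]].
by apply/mapP; exists x => //; rewrite mem_enum inE -sx.
Qed.

(** * Lower sets and their exact count *)

Definition below (m d t : nat) : nat := count (fun y => sumn y < t) (box m d).

(** A point [y] of dimension [d] extends to the layer [k] by a unique first coordinate [k - sumn y],
    provided that this lies in {0, ..., m - 1}. The other points have too small a sum, or too large
    a sum; reflection turns the latter into a lower set. *)
Lemma middle_below (m d k : nat) : 0 < m -> m.-1 <= k ->
  count (fun y => sumn y == k) (box m d.+1)
  + (below m d (k - m.-1) + below m d (d * m.-1 - k)) = m ^ d.
Proof.
move=> m0 mk.
have rev_below :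
  below m d (d * m.-1 - k) = count (fun y => k < sumn y) (box m d).
  rewrite /below -!sum1_count [LHS]big_mkcond [RHS]big_mkcond.
  transitivity
    (\sum_(y <- box m d) if d * m.-1 - sumn y < d * m.-1 - k then 1 else 0).
    exact: (box_sum_rev m d (fun u => if u < d * m.-1 - k then 1 else 0)).
  apply: eq_big_seq => y /sumn_box yb.
  by congr (if _ then _ else _); lia.
rewrite rev_below count_box -(size_box m d) /below -!sum1_count -sum1_size.
rewrite ![X in _ + (X + _)]big_mkcond ![X in _ + (_ + X)]big_mkcond.
rewrite -!big_split /=; apply: eq_bigr => y _.
have -> : count (fun i => i + sumn y == k) (iota 0 m)
    = (sumn y <= k < sumn y + m) :> nat.
  case: (leqP (sumn y) k) => yk; last first.
    by apply/eqP; rewrite -leqn0 leqNgt -has_count; apply/hasPn => i _; lia.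
  rewrite -(eq_count (a1 := pred1 (k - sumn y))) => [|i /=]; last by lia.
  by rewrite count_uniq_mem ?iota_uniq // mem_iota; lia.
case: (ltnP _ (k - m.-1)) => ?; case: (ltnP k) => ?; case: leqP => ? /=; lia.
Qed.

Lemma belowS (m d t : nat) :
  below m d.+1 t = \sum_(0 <= i < m) below m d (t - i).
Proof.
rewrite /below count_box.
transitivity (\sum_(y <- box m d) \sum_(0 <= i < m) (sumn y < t - i : nat)).
  apply: eq_bigr => y _; rewrite -sum1_count big_mkcond /index_iota subn0.
  by apply: eq_bigr => i _ /=; rewrite ltn_subRL; case: ifP.
rewrite exchange_big; apply: eq_bigr => i _.
by rewrite -sum1_count [RHS]big_mkcond.
Qed.

(* The number of [d]-tuples of natural numbers with sum smaller than [t]; the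
   case [d = 0] is separate because ['C(t - 1, 0)] would be 1 at [t = 0]. *)
Definition simplex (d t : nat) : nat :=
  if d is d'.+1 then 'C(t + d', d) else (0 < t).

(** This is Pascal's rule; at [t = 0] it survives truncation because [simplex d 0] is 0. *)
Lemma simplexS (d t : nat) :
  simplex d.+1 t = simplex d.+1 t.-1 + simplex d t.
Proof.
case: t => [|t]; first by case: d => [|d] //=; rewrite !bin_small.
by rewrite /= addSn binS; case: d => [|d]; rewrite ?bin0 //= addnS.
Qed.

Lemma sum_simplex (d t m : nat) :
  \sum_(0 <= i < m) simplex d (t - i) + simplex d.+1 (t - m) = simplex d.+1 t.
Proof.
elim: m => [|m IH]; first by rewrite big_geq // subn0.
by rewrite big_nat_recr // -IH [in RHS]simplexS subnS -addnA [X in _ + X]addnC.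
Qed.

Local Open Scope ring_scope.

(** In terms of the shift operator [E] this is [(1 - E)^(d+1) = (1 - E)^d (1 - E)]. *)
Lemma alternating_binomS (R : comNzRingType) (d : nat) (a : nat -> R) :
  \sum_(0 <= i < d.+2) (-1) ^+ i * 'C(d.+1, i)%:R * a i
  = \sum_(0 <= i < d.+1) (-1) ^+ i * 'C(d, i)%:R * (a i - a i.+1).
Proof.
rewrite big_nat_recl // bin0.
under eq_bigr => i _ do rewrite binS natrD mulrDr mulrDl.
rewrite big_split /= big_nat_recr //= bin_small // mulr0 mul0r addr0.
under [RHS]eq_bigr => i _ do rewrite mulrBr.
rewrite sumrB [X in _ = X - _]big_nat_recl //= bin0 addrA; congr (_ + _).
by rewrite -sumrN; apply: eq_bigr => i _; rewrite exprS; ring.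
Qed.

(** The index [i] counts coordinates forced to be at least [m]. In the induction, summing over the
    new coordinate telescopes each [simplex] into a difference of values at [i] and [i.+1], as
    [alternating_binomS] requires. *)
Lemma below_inclusion_exclusion (R : comNzRingType) (m d t : nat) :
  (below m d t)%:R
  = \sum_(0 <= i < d.+1) (-1) ^+ i * 'C(d, i)%:R * (simplex d (t - i * m))%:R
  :> R.
Proof.
elim: d t => [|d IH] t.
  by rewrite big_nat1 mul0n subn0 expr0 bin0 !mul1r /below /= addn0.
rewrite belowS natr_sum alternating_binomS.
under eq_bigr => j _ do rewrite IH.
rewrite exchange_big; apply: eq_bigr => i _; rewrite -mulr_sumr; congr (_ * _).
rewrite -(sum_simplex d _ m) natrD mulSn addnC subnDA addrK natr_sum.
by apply: eq_bigr => j _; rewrite subnAC.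
Qed.

(** * Asymptotics of the lower sets *)

Lemma exprB_le (R : realDomainType) (M x y : R) (d : nat) :
  0 <= x <= M -> 0 <= y <= M ->
  `|x ^+ d.+1 - y ^+ d.+1| <= d.+1%:R * `|x - y| * M ^+ d.
Proof.
move=> /andP[x0 xM] /andP[y0 yM]; have M0 := le_trans x0 xM.
rewrite subrXX normrM mulrAC mulrC ler_wpM2r //.
apply: le_trans (ler_norm_sum _ _ _) _.
rewrite mulr_natl -[X in _ *+ X]card_ord -sumr_const ler_sum // => i _.
rewrite normrM !normrX !ger0_norm //.
have -> : M ^+ d = M ^+ (d.+1 - 1 - i) * M ^+ i.
  by rewrite -exprD; congr (_ ^+ _); have := ltn_ord i; lia.
rewrite subSS subn0 ler_pM ?exprn_ge0 ?lerXn2r ?nnegrE //.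
Qed.

Lemma simplex_bounds (d t : nat) :
  (t ^ d.+1 <= simplex d.+1 t * d.+1`! <= (t + d) ^ d.+1)%N.
Proof.
rewrite bin_ffact; apply/andP; split.
  elim: d => [|d IH]; first by rewrite addn0 ffactn1.
  by rewrite addnS ffactSS expnS leq_mul // -addnS leq_addr.
rewrite ffact_prod -[X in (_ <= _ ^ X)%N]card_ord -prod_nat_const.
by apply: leq_prod => i _; rewrite leq_subr.
Qed.

(** Up to the factorial, [simplex d.+1 t] lies between the powers of [t] and [t + d]. Both bases are
    within [c + d] of [y] and at most [(B + d) * M], so [exprB_le] applies to each. *)
Lemma simplex_asymptotics (R : realFieldType) (d t : nat) (c B y M : R) :
  0 <= y <= B * M -> t%:R <= B * M -> `|t%:R - y| <= c -> 1 <= M ->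
  `|(simplex d.+1 t)%:R - y ^+ d.+1 / d.+1`!%:R|
    <= d.+1%:R * (c + d%:R) * (B + d%:R) ^+ d / d.+1`!%:R * M ^+ d.
Proof.
move=> /andP[y0 yB] tB tc M1.
have f0 : 0 < d.+1`!%:R :> R by rewrite ltr0n fact_gt0.
have dM : d%:R <= d%:R * M by rewrite ler_peMr.
have c0 : 0 <= c := le_trans (normr_ge0 _) tc.
have E (u : R) : 0 <= u <= (B + d%:R) * M -> `|u - y| <= c + d%:R ->
    `|u ^+ d.+1 - y ^+ d.+1| <= d.+1%:R * (c + d%:R) * (B + d%:R) ^+ d * M ^+ d.
  move=> uB uy; apply: le_trans (exprB_le d uB _) _.
    by rewrite y0 mulrDl; have := ler0n R d; nra.
  have BM : 0 <= (B + d%:R) * M by case/andP: uB; exact: le_trans.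
  rewrite exprMn !mulrA -mulrA -[leRHS]mulrA ler_wpM2r //.
    by rewrite -exprMn exprn_ge0.
  by rewrite ler_wpM2l.
have := simplex_bounds d t; rewrite -!(ler_nat R) natrM !natrX natrD.
move=> /andP[lo hi].
set D := d.+1%:R * _ * _ in E *.
have d0 := ler0n R d; have t0 := ler0n R t.
have ub : `|(t%:R + d%:R) ^+ d.+1 - y ^+ d.+1| <= D * M ^+ d.
  apply: E; first by rewrite addr_ge0 //= mulrDl lerD.
  by rewrite addrAC (le_trans (ler_normD _ _)) // lerD // ger0_norm.
have lb : `|t%:R ^+ d.+1 - y ^+ d.+1| <= D * M ^+ d.
  by apply: E; [rewrite t0 mulrDl /=; nra|lra].
rewrite mulrAC ler_pdivlMr // -[X in _ * X](gtr0_norm f0) -normrM.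
rewrite mulrBl divfK ?gt_eqF //.
move: ub lb; rewrite !ler_norml; lra.
Qed.

(* The probability that [d] independent uniform variables on [0, 1] have sum
   at most [x]. *)
Definition irwin_hall (R : realFieldType) (d : nat) (x : R) : R :=
  \sum_(0 <= i < d.+1)
    (-1) ^+ i * (Num.max (x - i%:R) 0 ^+ d / (i`!%:R * (d - i)`!%:R)).

Lemma distr_max0 (R : realDomainType) (x y : R) :
  `|Num.max x 0 - Num.max y 0| <= `|x - y|.
Proof.
have := ler_norm (x - y); have := ler_norm (y - x); rewrite (distrC y).
have := normr_ge0 (x - y).
case: (leP x 0) => x0; case: (leP y 0) => y0 n0 h1 h2; rewrite ler_norml; lra.
Qed.

Lemma natrB_max0 (R : realDomainType) (a b : nat) :
  (a - b)%:R = Num.max (a%:R - b%:R) 0 :> R.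
Proof.
case: (leqP b a) => ab; first by rewrite natrB // max_l // subr_ge0 ler_nat.
by rewrite max_r ?subr_le0 ?ler_nat ?(ltnW ab) //; move/ltnW: ab => /eqP ->.
Qed.

Lemma below_asymptotics (R : realFieldType) (d : nat) (x c : R) :
  exists K : R, forall m t : nat, (0 < m)%N -> `|t%:R - x * m%:R| <= c ->
    `|(below m d.+1 t)%:R - m%:R ^+ d.+1 * irwin_hall d.+1 x| <= K * m%:R ^+ d.
Proof.
pose B := `|x| + c.
exists (\sum_(0 <= i < d.+2) 'C(d.+1, i)%:R *
  (d.+1%:R * (c + d%:R) * (B + d%:R) ^+ d / d.+1`!%:R)) => m t m0 tx.
have M1 : 1 <= m%:R :> R by rewrite (ler_nat R 1).
have c0 : 0 <= c := le_trans (normr_ge0 _) tx.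
rewrite below_inclusion_exclusion /irwin_hall mulr_sumr -sumrB mulr_suml.
apply: le_trans (ler_norm_sum _ _ _) _.
rewrite !big_nat ler_sum // => i /andP[_ id].
(* The real counterpart of [t - i * m]: the positive part mirrors truncated subtraction and, being
   1-Lipschitz, keeps the error at most [c]. *)
pose y := Num.max (x - i%:R) 0 * m%:R.
have yE : y = Num.max (x * m%:R - i%:R * m%:R) 0.
  by rewrite /y maxr_pMl ?ler0n // mul0r mulrBl.
have -> : (-1) ^+ i * 'C(d.+1, i)%:R * (simplex d.+1 (t - i * m))%:R -
    m%:R ^+ d.+1 * ((-1) ^+ i *
      (Num.max (x - i%:R) 0 ^+ d.+1 / (i`!%:R * (d.+1 - i)`!%:R)))
  = (-1) ^+ i * ('C(d.+1, i)%:R * ((simplex d.+1 (t - i * m))%:R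
      - y ^+ d.+1 / d.+1`!%:R)).
  have fE : d.+1`!%:R = 'C(d.+1, i)%:R * (i`!%:R * (d.+1 - i)`!%:R) :> R.
    by rewrite -!natrM bin_fact.
  have bin_neq0 : 'C(d.+1, i)%:R != 0 :> R by rewrite pnatr_eq0 -lt0n bin_gt0.
  rewrite fE /y exprMn; field.
  by rewrite bin_neq0 !pnatr_eq0 -!lt0n !fact_gt0.
rewrite normrM normrX normrN1 expr1n mul1r normrM normr_nat -mulrA.
apply: ler_wpM2l; first exact: ler0n.
have xn := ler_norm x.
have tB : t%:R <= B * m%:R.
  move: tx; rewrite ler_norml /B => /andP[_].
  have : x * m%:R <= `|x| * m%:R by rewrite ler_wpM2r.
  have : c <= c * m%:R by rewrite ler_peMr.
  rewrite mulrDl; lra.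
apply: simplex_asymptotics => //.
- rewrite /y mulr_ge0 ?le_max ?lexx ?orbT //= ler_wpM2r //.
  rewrite ge_max /B; have := ler0n R i; have := normr_ge0 x; lra.
- by apply: le_trans tB; rewrite ler_nat leq_subr.
- apply: le_trans tx; rewrite natrB_max0 natrM yE.
  apply: le_trans (distr_max0 _ _) _.
  by rewrite (_ : _ - _ = t%:R - x * m%:R) //; ring.
Qed.

(** * Evaluation of the closed form *)

Lemma sum_pow_widen (R : fieldType) (d J : nat) : (0 < d)%N ->
  \sum_(0 <= i < J)
    (-1) ^+ i * ((J%:R - i%:R) ^+ d / (i`!%:R * (d - i)`!%:R))
  = \sum_(0 <= i < J.+1)
      (-1) ^+ i * ((J%:R - i%:R) ^+ d / (i`!%:R * (d - i)`!%:R)) :> R.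
Proof.
move=> d0; rewrite [RHS]big_nat_recr //= subrr expr0n gtn_eqF //.
by rewrite mul0r mulr0 addr0.
Qed.

(** For fixed [i] the terms telescope over [j]; the start [j = i] leaves a power of 0, which
    vanishes as the exponent is positive. *)
Lemma sum_g_term (R : realType) (n J : nat) : (1 < n)%N ->
  \sum_(0 <= j < J) \sum_(0 <= i < j.+1) g_term R n j i
  = \sum_(0 <= i < J)
      (-1) ^+ i * ((J%:R - i%:R) ^+ (n - 1) / (i`!%:R * (n - 1 - i)`!%:R)).
Proof.
move=> n1; elim: J => [|J IH]; first by rewrite !big_geq.
rewrite big_nat_recr //= IH.
rewrite sum_pow_widen ?subn_gt0 //.
rewrite -big_split; apply: eq_bigr => i _ /=.
by rewrite /g_term -mulrDr -mulrDl addrC subrK [1 + _]addrC natr1.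
Qed.

Lemma irwin_hall_trunc (R : realFieldType) (d J : nat) (x : R) :
  (0 < d)%N -> (J <= d.+1)%N -> J%:R - 1 <= x <= J%:R ->
  irwin_hall d x
  = \sum_(0 <= i < J) (-1) ^+ i * ((x - i%:R) ^+ d / (i`!%:R * (d - i)`!%:R)).
Proof.
move=> d0 Jd /andP[Jx xJ].
rewrite /irwin_hall (big_cat_nat _ Jd) //= [X in _ + X]big1_seq ?addr0.
  apply: eq_big_nat => i /andP[_ iJ]; rewrite max_l // subr_ge0.
  by apply: le_trans Jx; rewrite lerBrDr natr1 ler_nat.
move=> i /andP[_]; rewrite mem_index_iota => /andP[Ji _].
rewrite max_r ?expr0n ?gtn_eqF // ?mul0r ?mulr0 // subr_le0.
by apply: le_trans xJ _; rewrite ler_nat.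
Qed.

Lemma g_irwin_hall (R : realType) (n : nat) : (1 < n)%N ->
  g R n = 1 - 2 * irwin_hall (n - 1) (n%:R / 2 - 1).
Proof.
move=> n1; rewrite /g; have := odd_double_half n.
case: ifP => _ nE.
(* Here [n / 2 - 1] is [J + 1/2], so [J + 1] terms survive; the last sum of [g_odd] moves the
   evaluation point there from [J]. *)
- pose J := (n - 3)./2; have nJ : n = J.*2.+3 by rewrite /J; lia.
  have nR : n%:R = 2 * J%:R + 3 :> R by rewrite nJ -mul2n -addn3 natrD natrM.
  rewrite /g_odd -/J sum_g_term // (irwin_hall_trunc (J := J.+1)); try lia;
    last by rewrite nR -natr1; apply/andP; split; lra.
  rewrite sum_pow_widen ?subn_gt0 //.
  rewrite -addrA -opprD -mulrDr -big_split; congr (1 - 2 * _).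
  apply: eq_bigr => i _ /=.
  have -> : (n%:R - 3) / 2 = J%:R :> R by rewrite nR; field.
  by rewrite -mulrDr -mulrDl addrC subrK.
(* Here [n / 2 - 1] is the integer [J] itself, the right end of the range in [irwin_hall_trunc]. *)
- pose J := (n - 2)./2; have nJ : n = J.*2.+2 by rewrite /J; lia.
  have nR : n%:R / 2 - 1 = J%:R :> R.
    by rewrite nJ -mul2n -addn2 natrD natrM; field.
  rewrite /g_even -/J sum_g_term // (irwin_hall_trunc (J := J)) ?nR //; try lia.
  by rewrite lexx andbT gerBl.
Qed.

(** * Thresholds of the middle layer and conclusion *)

(** With [n = d + 2], both thresholds of [middle_below] lie within [(d + 2) / 2] of [(n / 2 - 1) m];
    doubling keeps the bounds in the natural numbers. *)
Lemma middle_window (d m : nat) (l := ((d.+2 * m.-1)./2)%N) : (0 < m)%N ->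
  [/\ (m.-1 <= l)%N,
      ((l - m.-1).*2 <= d * m + d.+2)%N, (d * m <= (l - m.-1).*2 + d.+2)%N,
      ((d.+1 * m.-1 - l).*2 <= d * m + d.+2)%N
    & (d * m <= (d.+1 * m.-1 - l).*2 + d.+2)%N].
Proof.
rewrite {}/l; case: m => [//|p] _ /=; set l := _./2; rewrite mulnS.
have lE : (l.*2 + odd (d.+2 * p) = d * p + p.*2)%N.
  by rewrite addnC odd_double_half; lia.
have -> : (d.+1 * p = d * p + p)%N by lia.
move: (d * p)%N (odd _) lE => q b lE.
by case: b lE => lE; split; lia.
Qed.

Local Open Scope classical_set_scope.
Local Open Scope ring_scope.

Theorem theorem3 (R : realType) (n : nat) (hn : (2 <= n)%N) :
  (fun m : nat => (max_antichain m n)%:R : R^o) =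
    (fun m : nat => m%:R ^+ (n - 1) * g R n : R^o)
    +O_\oo (fun m : nat => m%:R ^+ (n - 2) : R^o).
Proof.
rewrite g_irwin_hall //.
have [d nE] : exists d, n = d.+2 by exists (n - 2)%N; lia.
rewrite {}nE subn1 subn2 /= in hn *.
set x : R := _ - 1.
have [K HK] := below_asymptotics d x d.+2%:R.
(* The two lower sets contribute an error of at most [K * m ^ d] each. *)
apply/eqaddOP; exists (2 * K); split; first exact: num_real.
move=> k Kk; near=> m.
have m0 : (0 < m)%N by near: m; exact: nbhs_infty_gt.
have [lm] := middle_window d m0; set l := _./2 in lm *.
move=> lo_le lo_ge hi_le hi_ge.
have near_x (t : nat) : (t.*2 <= d * m + d.+2)%N ->
    (d * m <= t.*2 + d.+2)%N -> `|t%:R - x * m%:R| <= d.+2%:R.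
  have -> : x = d%:R / 2 by rewrite /x -addn2 natrD; field.
  rewrite -!(ler_nat R) !natrD natrM -mul2n natrM => h1 h2.
  by rewrite ler_norml; apply/andP; split; lra.
have := middle_below d.+1 m0 lm.
rewrite -(max_antichain_middle d.+2 m0) => /(congr1 (fun u => u%:R : R)).
rewrite !natrD natrX => SE.
have h1 := HK m _ m0 (near_x _ lo_le lo_ge).
have h2 := HK m _ m0 (near_x _ hi_le hi_ge).
rewrite -[X in `|X|]/((max_antichain m d.+2)%:R
  - m%:R ^+ d.+1 * (1 - 2 * irwin_hall d.+1 x)).
rewrite [`|m%:R ^+ d : R^o|]ger0_norm ?exprn_ge0 //.
apply: (@le_trans _ _ (2 * K * m%:R ^+ d)); last first.
  by rewrite ler_wpM2r ?exprn_ge0 // ltW.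
rewrite !ler_norml in h1 h2 *; move: h1 h2 => /andP[? ?] /andP[? ?].
apply/andP; split; lra.
Unshelve. all: by end_near.
Qed.
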